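(* Let $S$ be an integral domain that is not a field, let $F$ be its field of fractions, let $A \neq F$ be an $F$-algebra, and let $\mathbb{S}$ be the set of all $S$-nice subalgebras of $A$, assumed nonempty, endowed with the topology described in the context and partially ordered by inclusion. A subset $I \subseteq \mathbb{S}$ is an irreducible component of $\mathbb{S}$ if and only if $I = \mathrm{cl}\{R\}$ for some maximal element $R$ of $\mathbb{S}$.
   Context: Algebras are associative and unital, not necessarily commutative, and $F$ is identified with its image in $A$. An $S$-subalgebra $R$ of $A$ is called $S$-nice if $R \cap F = S$ and $FR = A$ (where $FR$ is the set of finite sums $\sum t_i r_i$, $t_i \in F$, $r_i \in R$). For $M \subseteq A$ let $V(M)$ be the set of all $S$-nice subalgebras of $A$ containing $M$. The sets $V(M)$, $M \subseteq A$, form a basis of the topology on $\mathbb{S}$; equivalently, a subset of $\mathbb{S}$ is open iff it is an upper set with respect to inclusion, and closed iff it is a lower set with respect to inclusion. $\mathrm{cl}$ denotes closure in $\mathbb{S}$. A subset $I$ of a topological space is irreducible if it is nonempty and whenever $I \subseteq G_1 \cup G_2$ with $G_1, G_2$ closed, then $I \subseteq G_1$ or $I \subseteq G_2$. An irreducible component is an irreducible subset that is maximal with respect to inclusion. *)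

(* Defs.v *)
From HB Require Import structures.
From mathcomp Require Export all_boot all_order all_algebra.
From mathcomp Require Export all_classical topology.

Set Implicit Arguments.
Unset Strict Implicit.
Unset Printing Implicit Defensive.

Import GRing.Theory.
Local Open Scope classical_set_scope.
Local Open Scope ring_scope.

Section NiceSubalgebras.
Variables (S : idomainType) (A : algType {fraction S}).

(* An [algType] is nontrivial, so this image is a copy of the field [{fraction S}]. *)
Definition scalar_image : set A := range (fun t : {fraction S} => t%:A).

Definition base_image : set A := range (fun s : S => (FracField.tofrac s)%:A).

(* [S] acts on [A] through its embedding in [{fraction S}]. *)
Record is_subalgebra (R : set A) : Prop := {
  subalgebra1 : R 1;
  subalgebraB : forall x y, R x -> R y -> R (x - y);
  subalgebraM : forall x y, R x -> R y -> R (x * y);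
  subalgebraZ : forall (s : S) x, R x -> R (FracField.tofrac s *: x)
}.

Definition fraction_span (R : set A) : set A :=
  [set a | exists (n : nat) (t : 'I_n -> {fraction S}) (r : 'I_n -> A),
     (forall i, R (r i)) /\ a = \sum_(i < n) t i *: r i].

Record is_nice (R : set A) : Prop := {
  nice_subalgebra : is_subalgebra R;
  nice_lying_over : R `&` scalar_image = base_image;
  nice_span : fraction_span R = setT
}.

Record niceSubalgebra := NiceSubalgebra {
  nice_carrier :> set A;
  nice_carrierP : is_nice nice_carrier
}.

Lemma nice_carrier_inj : injective nice_carrier.
Proof.
case=> [R nR] [R' nR'] /= eqR; rewrite eqR in nR *.
by rewrite (Prop_irrelevance nR nR').
Qed.

Definition nice_above (M : set A) : set niceSubalgebra :=
  [set R | M `<=` nice_carrier R].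

Definition maximal_nice (R : niceSubalgebra) : Prop :=
  forall R' : niceSubalgebra, nice_carrier R `<=` nice_carrier R' -> R' = R.

HB.instance Definition _ := gen_eqMixin niceSubalgebra.
HB.instance Definition _ := gen_choiceMixin niceSubalgebra.

Lemma nice_above_cover : \bigcup_(M in [set: set A]) nice_above M = setT.
Proof. by apply/seteqP; split=> // R _; exists set0. Qed.

Lemma nice_above_join (M N : set A) (R : niceSubalgebra) :
  setT M -> setT N -> nice_above M R -> nice_above N R ->
  exists K, [/\ setT K, nice_above K R &
                nice_above K `<=` nice_above M `&` nice_above N].
Proof.
move=> _ _ MR NR; exists (M `|` N); split=> //; first by rewrite /nice_above /= subUset.
by move=> Q; rewrite /nice_above /= subUset.
Qed.

HB.instance Definition _ :=
  isBaseTopological.Build niceSubalgebra nice_above_cover nice_above_join.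

Lemma open_niceP (U : set niceSubalgebra) :
  open U <-> forall P Q : niceSubalgebra,
    U P -> nice_carrier P `<=` nice_carrier Q -> U Q.
Proof.
split=> [[D' _ <-] P Q [M D'M MP] PQ | upU].
  by exists M => //; exact: subset_trans MP PQ.
exists [set M | exists2 P, U P & M = nice_carrier P] => //.
apply/seteqP; split=> [Q [_ [P UP ->]] PQ | Q UQ]; first exact: upU UP PQ.
by exists (nice_carrier Q) => //; exists Q.
Qed.

Lemma closed_niceP (G : set niceSubalgebra) :
  closed G <-> forall P Q : niceSubalgebra,
    G Q -> nice_carrier P `<=` nice_carrier Q -> G P.
Proof.
rewrite -openC open_niceP; split=> GP P Q.
  by move=> GQ PQ; apply: contrapT => /GP /(_ PQ).
by move=> nGP PQ GQ; apply: nGP; exact: GP PQ.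
Qed.

End NiceSubalgebras.

Arguments scalar_image {S} A.
Arguments base_image {S} A.

Section Irreducible.
Variable T : topologicalType.

Definition irreducible_set (I : set T) : Prop :=
  I !=set0 /\
  forall G1 G2 : set T, closed G1 -> closed G2 ->
    I `<=` G1 `|` G2 -> I `<=` G1 \/ I `<=` G2.

Definition irreducible_component (I : set T) : Prop :=
  irreducible_set I /\
  forall J : set T, irreducible_set J -> I `<=` J -> J = I.

End Irreducible.

(* Main.v *)
Require Import Defs.

Set Implicit Arguments.
Unset Strict Implicit.
Unset Printing Implicit Defensive.

Import GRing.Theory.
Local Open Scope classical_set_scope.
Local Open Scope ring_scope.

(** Closed sets are the lower sets for inclusion, so the closure of a point
    [R] is the set of nice subalgebras below [R], and an irreducible set [J]
    is upward directed ([irreducible_directed]): the subalgebras that fail to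
    contain a given [P] form a closed set, and two such sets cover [J] exactly
    when the two given subalgebras have no common upper bound in [J].

    The algebra enters at one point only: the union of a directed family of
    nice subalgebras is again nice ([nice_bigcup]).  Hence an irreducible set
    [J] lies below a single point, its union, whose closure is irreducible; a
    maximal irreducible [J] must therefore be the closure of its union, and
    this union is maximal because distinct comparable points have distinct
    nested closures.  Conversely, if [R] is maximal and belongs to an
    irreducible [J], directedness puts every member of [J] below [R]. *)

Section NiceSpace.
Variables (S : idomainType) (A : algType {fraction S}).
Implicit Types (P Q R : niceSubalgebra A) (J : set (niceSubalgebra A)).

Definition directed_nice J : Prop :=
  J !=set0 /\
  forall P Q, J P -> J Q ->
    exists K, [/\ J K, nice_carrier P `<=` nice_carrier K &
                       nice_carrier Q `<=` nice_carrier K].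

Lemma closure_niceP R P :
  closure [set R] P <-> nice_carrier P `<=` nice_carrier R.
Proof.
split=> [clP | PR].
- have closedR :
      closed [set Q : niceSubalgebra A | nice_carrier Q `<=` nice_carrier R].
    by apply/closed_niceP => P' Q /= QR P'Q; exact: subset_trans P'Q QR.
  by move: clP; rewrite closureE => /(_ _ (conj closedR _)); apply=> Q ->.
- have /closed_niceP closedR := @closed_closure _ [set R].
  by apply: closedR PR; exact: subset_closure.
Qed.

Lemma closed_not_above P :
  closed [set Q : niceSubalgebra A | ~ nice_carrier P `<=` nice_carrier Q].
Proof.
by apply/closed_niceP => Q Q' /= nPQ' QQ' PQ; apply/nPQ'/(subset_trans PQ).
Qed.

(** If [P] and [Q] in [J] had no common upper bound in [J], the closed sets
    of subalgebras not above [P] and not above [Q] would cover [J]; but the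
    first misses [P] and the second misses [Q]. *)
Lemma irreducible_directed J : irreducible_set J -> directed_nice J.
Proof.
move=> [J0 irrJ]; split=> // P Q JP JQ; apply: contrapT => nK.
have cover : J `<=` [set K | ~ nice_carrier P `<=` nice_carrier K] `|`
                    [set K | ~ nice_carrier Q `<=` nice_carrier K].
  move=> K JK; have [PK|nPK] := pselect (nice_carrier P `<=` nice_carrier K).
    by right=> QK; apply: nK; exists K.
  by left.
have [JnP|JnQ] := irrJ _ _ (@closed_not_above P) (@closed_not_above Q) cover.
- exact: JnP JP _.
- exact: JnQ JQ _.
Qed.

(** A closed set containing [R] contains everything below [R], so a closed
    cover is decided by the piece that contains [R]. *)
Lemma irreducible_closure1 R : irreducible_set (closure [set R]).
Proof.
split; first by exists R; exact: subset_closure.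
move=> G1 G2 /closed_niceP G1low /closed_niceP G2low clG.
have [G1R|G2R] := clG R (subset_closure (erefl R)).
- by left=> P /closure_niceP; exact: G1low.
- by right=> P /closure_niceP; exact: G2low.
Qed.

(** The subalgebra axioms involve at most two elements of the union, which
    directedness places in one member; lying over the base ring is checked
    elementwise; and spanning is inherited from any single member. *)
Lemma nice_bigcup J :
  directed_nice J -> is_nice (\bigcup_(P in J) nice_carrier P).
Proof.
move=> [[P0 JP0] dirJ]; split.
- have pair x y : (\bigcup_(P in J) nice_carrier P) x ->
      (\bigcup_(P in J) nice_carrier P) y ->
      exists2 K, J K & nice_carrier K x /\ nice_carrier K y.
    move=> [P JP Px] [Q JQ Qy]; have [K [JK PK QK]] := dirJ _ _ JP JQ.
    by exists K => //; split; [exact: PK | exact: QK].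
  split.
  + by exists P0 => //; exact: subalgebra1 (nice_subalgebra (nice_carrierP P0)).
  + move=> x y Ux Uy; have [K JK [Kx Ky]] := pair _ _ Ux Uy; exists K => //.
    exact: (subalgebraB (nice_subalgebra (nice_carrierP K))).
  + move=> x y Ux Uy; have [K JK [Kx Ky]] := pair _ _ Ux Uy; exists K => //.
    exact: (subalgebraM (nice_subalgebra (nice_carrierP K))).
  + move=> s x [P JP Px]; exists P => //.
    exact: (subalgebraZ (nice_subalgebra (nice_carrierP P))).
- apply/seteqP; split=> [x [[P JP Px] Fx] | x Sx].
    by rewrite -(nice_lying_over (nice_carrierP P)).
  move: Sx; rewrite -(nice_lying_over (nice_carrierP P0)) => -[P0x Fx].
  by split=> //; exists P0.
- apply/seteqP; split=> // a _.
  have : fraction_span (nice_carrier P0) a.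
    by rewrite (nice_span (nice_carrierP P0)).
  move=> [n [t [r [P0r ->]]]]; exists n, t, r; split=> // i.
  by exists P0.
Qed.

Lemma irreducible_sub_closure1 J :
  irreducible_set J -> exists R, J `<=` closure [set R].
Proof.
move=> /irreducible_directed/nice_bigcup niceU.
exists (NiceSubalgebra niceU) => P JP; apply/closure_niceP => x Px.
by exists P.
Qed.

End NiceSpace.

Theorem proposition2p12 (S : idomainType) (A : algType {fraction S})
    (S_not_field : ~ GRing.field_axiom S)
    (A_neq_F : scalar_image A <> [set: A])
    (nice_nonempty : [set: niceSubalgebra A] !=set0)
    (I : set (niceSubalgebra A)) :
  irreducible_component I <->
  exists2 R : niceSubalgebra A, maximal_nice R & I = closure [set R].
Proof.
split=> [[irrI maxI] | [R maxR ->]].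
- have [R IR] := irreducible_sub_closure1 irrI.
  have eqI := maxI _ (irreducible_closure1 R) IR.
  exists R => // R' RR'.
  (* Maximality of [I] identifies the closures of [R] and [R'], and a point is
     determined by its closure. *)
  have IR' : I `<=` closure [set R'].
    by move=> P /IR/closure_niceP PR; apply/closure_niceP/(subset_trans PR).
  have /closure_niceP R'R : closure [set R] R'.
    rewrite eqI -(maxI _ (irreducible_closure1 R') IR').
    exact: subset_closure.
  by apply: nice_carrier_inj; apply/seteqP.
- split=> [|J /irreducible_directed[_ dirJ] RJ].
    exact: irreducible_closure1.
  apply/seteqP; split=> // P JP.
  have JR : J R by apply: RJ; exact: subset_closure.
  have [K [_ PK /maxR KR]] := dirJ _ _ JP JR.
  by apply/closure_niceP; rewrite -KR.
Qed.
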